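(* Let $n\in\mathbb{N}_0$ and define $$y\left(n,\tfrac12\right)=\sum_{j=0}^{n}\frac{(-1)^{n}}{(j+1)\left(\tfrac12\right)^{j+1}\left(\tfrac12-1\right)^{n+1-j}}.$$ Then $$\int_{0}^{1}\frac{1-x^{\lfloor n/2\rfloor}}{1-x}\,dx-\int_{0}^{1}\frac{1-x^{n}}{1-x}\,dx=\frac{y\left(n,\tfrac12\right)}{2^{n+2}}+\frac{(-1)^{n}}{n+1},$$ where $\lfloor\cdot\rfloor$ denotes the integer part. *)

(* Defs.v *)
From Stdlib Require Import Reals.
Open Scope R_scope.

(** The sum has the [n + 1] terms 0 <= j <= n, so the [nat] subtraction
    [n + 1 - j] is never truncated. *)
Definition y (n : nat) (lambda : R) : R :=
  sum_f_R0
    (fun j : nat =>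
       (-1) ^ n
       / (INR (j + 1) * lambda ^ (j + 1) * (lambda - 1) ^ (n + 1 - j)))
    n.

(* Main.v *)
Require Import Defs.
From Stdlib Require Import Reals Lra Lia.
From Coquelicot Require Import Coquelicot.
Open Scope R_scope.

(** Both integrals are harmonic numbers, [H (n / 2)] and [H n]. At [1 / 2] the
    powers of two in [y] factor out, leaving the alternating harmonic sum
    [- 1 + 1 / 2 - ... + (-1) ^ (n + 1) / (n + 1)], whose last term is cancelled
    by [(-1) ^ n / (n + 1)]. What remains is Catalan's identity: making the even
    terms of [- H n] positive adds twice their sum, which is [H (n / 2)]. *)

Fixpoint harmonic (n : nat) : R :=
  match n with
  | O => 0
  | S m => harmonic m + / INR (S m)
  end.

Lemma is_RInt_pow_0_1 (n : nat) :
  is_RInt (fun x : R => x ^ n) 0 1 (/ INR (S n)).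
Proof.
  assert (Hn : INR (S n) <> 0) by (apply not_0_INR; lia).
  replace (/ INR (S n))
    with (minus (1 ^ S n / INR (S n)) (0 ^ S n / INR (S n))).
  - apply (is_RInt_derive (fun x : R => x ^ S n / INR (S n))).
    + intros x _.
      auto_derive; [exact I |].
      replace (Init.Nat.pred (S n)) with n by reflexivity.
      change (match n with O => 1 | S _ => INR n + 1 end) with (INR (S n)).
      now field.
    + intros x _.
      apply (ex_derive_continuous (fun x : R => x ^ n)).
      now auto_derive.
  - rewrite pow1, pow_i by lia.
    change (1 / INR (S n) + - (0 / INR (S n)) = / INR (S n)).
    now field.
Qed.

(** Induction on [n]: raising the exponent by one adds [x ^ n] to the integrand, hence [/ INR (S n)]
    to the integral. *)
Lemma is_RInt_geometric (n : nat) :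
  is_RInt (fun x : R => (1 - x ^ n) / (1 - x)) 0 1 (harmonic n).
Proof.
  induction n as [| n IH].
  - apply is_RInt_ext with (fun _ : R => 0).
    + intros x _. simpl. unfold Rdiv. ring.
    + replace (harmonic 0) with (scal (1 - 0) 0)
        by (unfold scal; simpl; unfold mult; simpl; ring).
      exact (is_RInt_const 0 1 0).
  - apply is_RInt_ext with (fun x : R => plus ((1 - x ^ n) / (1 - x)) (x ^ n)).
    (* Agreement is needed only on the open interval, so the division by zero at [x = 1] never
       matters. *)
    + intros x Hx. rewrite Rmax_right in Hx by lra.
      change ((1 - x ^ n) / (1 - x) + x ^ n = (1 - x ^ S n) / (1 - x)).
      simpl. field. lra.
    + exact (is_RInt_plus _ _ _ _ _ _ IH (is_RInt_pow_0_1 n)).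
Qed.

(** If [S n] is odd, the half index stays put and only [- / INR (S n)] appears. If [S n = 2 * S m],
    the first term also gains [/ INR (S m)], twice [/ INR (S n)], which flips the sign. *)
Lemma harmonic_half_succ (n : nat) :
  harmonic (S n / 2) - harmonic (S n)
  = harmonic (n / 2) - harmonic n + (-1) ^ S n / INR (S n).
Proof.
  destruct (Nat.Even_or_Odd n) as [[m ->] | [m ->]].
  - replace (S (2 * m) / 2)%nat with m
      by (apply (Nat.div_unique _ 2 m 1); lia).
    replace (2 * m / 2)%nat with m
      by (apply (Nat.div_unique _ 2 m 0); lia).
    rewrite pow_1_odd.
    cbn [harmonic]. unfold Rdiv. ring.
  - replace (S (2 * m + 1) / 2)%nat with (S m)
      by (apply (Nat.div_unique _ 2 (S m) 0); lia).
    replace ((2 * m + 1) / 2)%nat with m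
      by (apply (Nat.div_unique _ 2 m 1); lia).
    replace (S (2 * m + 1)) with (2 * S m)%nat by lia.
    rewrite pow_1_even.
    replace (harmonic (2 * S m))
      with (harmonic (2 * m + 1) + / INR (2 * S m))
      by (replace (2 * S m)%nat with (S (2 * m + 1)) by lia; reflexivity).
    cbn [harmonic]. rewrite mult_INR.
    change (INR 2) with 2.
    field. apply not_0_INR; lia.
Qed.

Lemma alternating_harmonic (n : nat) :
  sum_f_R0 (fun j : nat => (-1) ^ S j / INR (S j)) n + (-1) ^ n / INR (S n)
  = harmonic (n / 2) - harmonic n.
Proof.
  induction n as [| n IH].
  - simpl. field.
  (* Both sides collapse to the sum up to [n]: on the left the correction cancels the new summand,
     on the right the old correction cancels the new increment. *)
  - rewrite harmonic_half_succ, <- IH, tech5.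
    cbn [pow]. unfold Rdiv. ring.
Qed.

Lemma y_half (n : nat) :
  y n (1 / 2) / 2 ^ (n + 2)
  = sum_f_R0 (fun j : nat => (-1) ^ S j / INR (S j)) n.
Proof.
  unfold y, Rdiv. rewrite Rmult_comm, scal_sum.
  apply sum_eq. intros j Hj.
  replace (j + 1)%nat with (S j) by lia.
  (* With [n = k + j] the exponents of [1 / 2] and [- 1 / 2] are [S j] and [S k]. Their sum [n + 2]
     does not depend on [j], and the sign left over is
     [(-1) ^ (k + j) / (-1) ^ S k = (-1) ^ S j]. *)
  destruct (Nat.le_exists_sub j n Hj) as [k [-> _]].
  replace (k + j + 1 - j)%nat with (S k) by lia.
  replace (k + j + 2)%nat with (S j + S k)%nat by lia.
  replace (1 * / 2 - 1) with (-1 * / 2) by field.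
  rewrite Rmult_1_l, Rpow_mult_distr, !pow_inv, !pow_add.
  assert (Hk : (-1) ^ k <> 0) by (apply pow_nonzero; lra).
  assert (H2 : forall i, 2 ^ i <> 0) by (intro i; apply pow_nonzero; lra).
  assert (HS : INR (S j) <> 0) by (apply not_0_INR; lia).
  cbn [pow]. field. repeat split; auto.
Qed.

Theorem theorem5 (n : nat) :
  RInt (fun x : R => (1 - x ^ (n / 2)%nat) / (1 - x)) 0 1
  - RInt (fun x : R => (1 - x ^ n) / (1 - x)) 0 1
  = y n (1 / 2) / 2 ^ (n + 2) + (-1) ^ n / INR (n + 1).
Proof.
  rewrite (is_RInt_unique _ _ _ _ (is_RInt_geometric (n / 2))).
  rewrite (is_RInt_unique _ _ _ _ (is_RInt_geometric n)).
  rewrite y_half, Nat.add_1_r.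
  symmetry. apply alternating_harmonic.
Qed.
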